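(* Suppose $(\mathcal{X},Y)$ is observed from $Y=\mathcal{X}(M)+Z$ with $M\in\mathbb{R}^p$, $\mathcal{X}:\mathbb{R}^p\to\mathbb{R}^n$ a linear operator, and $Z\in\mathbb{R}^n$ a noise vector. Suppose that (conditioning on the event that), for some given choice of localization radius $\lambda_n$, $$\|\mathcal{X}^*(Z)\|_{\mathcal{A}}^*\le\lambda_n.$$ Let $\hat M$ be a solution of the convex program $$\hat M=\arg\min_{M'}\left\{\|M'\|_{\mathcal{A}}:\ \|\mathcal{X}^*(Y-\mathcal{X}(M'))\|_{\mathcal{A}}^*\le\lambda_n\right\}.$$ Then $$\|\hat M-M\|_{\ell_2}\le\frac{2\,\gamma_{\mathcal{A}}(M)}{\phi_{\mathcal{A}}^2(M,\mathcal{X})}\lambda_n,\qquad\|\hat M-M\|_{\mathcal{A}}\le\frac{2\,\gamma_{\mathcal{A}}^2(M)}{\phi_{\mathcal{A}}^2(M,\mathcal{X})}\lambda_n,\qquad\|\mathcal{X}(\hat M-M)\|_{\ell_2}\le\frac{2\,\gamma_{\mathcal{A}}(M)}{\phi_{\mathcal{A}}(M,\mathcal{X})}\lambda_n.$$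
   Context: $\mathcal{A}\subset\mathbb{R}^p$ is a compact atom set whose elements are extreme points of $\mathrm{conv}(\mathcal{A})$, with $\mathrm{conv}(\mathcal{A})$ a symmetric convex body. Atomic norm: $\|x\|_{\mathcal{A}}=\inf\{t>0:x\in t\,\mathrm{conv}(\mathcal{A})\}$; dual norm: $\|x\|_{\mathcal{A}}^*=\sup\{\langle x,a\rangle:a\in\mathcal{A}\}$. $\mathcal{X}^*$ is the adjoint of $\mathcal{X}$. Tangent cone: $T_{\mathcal{A}}(x)=\mathrm{cone}\{h:\|x+h\|_{\mathcal{A}}\le\|x\|_{\mathcal{A}}\}$ with $\mathrm{cone}(S)=\{th:t\ge0,h\in S\}$. Local asphericity ratio: $\gamma_{\mathcal{A}}(M)=\sup\{\|h\|_{\mathcal{A}}/\|h\|_{\ell_2}:h\in T_{\mathcal{A}}(M),h\ne0\}$. Local lower isometry constant: $\phi_{\mathcal{A}}(M,\mathcal{X})=\inf\{\|\mathcal{X}(h)\|_{\ell_2}/\|h\|_{\ell_2}:h\in T_{\mathcal{A}}(M),h\ne0\}$. Bounds with $\phi_{\mathcal{A}}(M,\mathcal{X})=0$ in the denominator are read as $+\infty$. *)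

(* Defs.v *)
From mathcomp Require Import all_boot all_order all_algebra.
From mathcomp Require Import all_classical all_reals all_analysis.
Set Implicit Arguments.
Unset Strict Implicit.
Unset Printing Implicit Defensive.
Import Order.TTheory GRing.Theory Num.Theory.
Import numFieldNormedType.Exports.
Local Open Scope classical_set_scope.
Local Open Scope ring_scope.

(* The topology on 'rV[R]_p is the usual one, but its library norm `|x| is the
   sup norm, hence the explicit Euclidean structure. *)
Definition dotprod (R : realType) (p : nat) (u v : 'rV[R]_p) : R :=
  \sum_(i < p) u 0 i * v 0 i.

Definition l2norm (R : realType) (p : nat) (u : 'rV[R]_p) : R :=
  Num.sqrt (dotprod u u).

Definition adjoint (R : realType) (p n : nat)
    (X : {linear 'rV[R]_p -> 'rV[R]_n}) (z : 'rV[R]_n) : 'rV[R]_p :=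
  z *m (lin1_mx X)^T.

Lemma adjointP (R : realType) (p n : nat)
    (X : {linear 'rV[R]_p -> 'rV[R]_n}) (x : 'rV[R]_p) (z : 'rV[R]_n) :
  dotprod (X x) z = dotprod x (adjoint X z).
Proof.
have dotE m (u v : 'rV[R]_m) : dotprod u v = (u *m v^T) 0 0.
  by rewrite mxE; apply: eq_bigr => i _; rewrite mxE.
by rewrite !dotE /adjoint trmx_mul trmxK mulmxA mul_rV_lin1.
Qed.

Definition conv_hull (R : realType) (p : nat) (A : set 'rV[R]_p) :
    set 'rV[R]_p :=
  smallest (@convex_set R 'rV[R]_p) A.

Definition extreme_point (R : realType) (p : nat) (K : set 'rV[R]_p)
    (x : 'rV[R]_p) : Prop :=
  K x /\ forall (y z : 'rV[R]_p) (t : R), K y -> K z -> 0 < t -> t < 1 ->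
    x = t *: y + (1 - t) *: z -> y = x /\ z = x.

Definition symmetric_convex_body (R : realType) (p : nat)
    (K : set 'rV[R]_p) : Prop :=
  [/\ @convex_set R 'rV[R]_p K, compact K, interior K !=set0
    & forall x, K x -> K (- x)].

Definition atom_set (R : realType) (p : nat) (A : set 'rV[R]_p) : Prop :=
  [/\ compact A, A `<=` extreme_point (conv_hull A)
    & symmetric_convex_body (conv_hull A)].

(* For an atom set, the infimum and supremum in the next two definitions are
   over nonempty bounded sets, so real-valued inf and sup are genuine. *)
Definition atomic_norm (R : realType) (p : nat) (A : set 'rV[R]_p)
    (x : 'rV[R]_p) : R :=
  inf [set t : R | 0 < t /\ exists2 y, conv_hull A y & x = t *: y].

Definition dual_norm (R : realType) (p : nat) (A : set 'rV[R]_p)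
    (x : 'rV[R]_p) : R :=
  sup [set dotprod x a | a in A].

Definition cone (R : realType) (p : nat) (S : set 'rV[R]_p) : set 'rV[R]_p :=
  [set v | exists t : R, 0 <= t /\ exists2 h, S h & v = t *: h].

Definition tangent_cone (R : realType) (p : nat) (A : set 'rV[R]_p)
    (x : 'rV[R]_p) : set 'rV[R]_p :=
  cone [set h | atomic_norm A (x + h) <= atomic_norm A x].

(* When x = 0 the tangent cone is {0} and both constants below range over the
   empty set. The supremum of ratios, all nonnegative, is taken in [0, +oo], so
   it is then 0 (adding 0 to the set changes nothing otherwise), and the
   infimum is then +oo. *)
Definition asphericity (R : realType) (p : nat) (A : set 'rV[R]_p)
    (x : 'rV[R]_p) : \bar R :=
  ereal_sup (0%E |` [set (atomic_norm A h / l2norm h)%:E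
                       | h in tangent_cone A x `&` [set h | h != 0]]).

Definition lower_isometry (R : realType) (p n : nat) (A : set 'rV[R]_p)
    (x : 'rV[R]_p) (X : {linear 'rV[R]_p -> 'rV[R]_n}) : \bar R :=
  ereal_inf [set (l2norm (X h) / l2norm h)%:E
               | h in tangent_cone A x `&` [set h | h != 0]].

(* Division of extended reals with a / 0 = +oo for every a: the library's
   division gives 0 / 0 = 0 * +oo = 0. As in the library, a / +oo = 0 for
   a finite. *)
Definition bound_div (R : realType) (a b : \bar R) : \bar R :=
  if b == 0%E then +oo%E else (a / b)%E.

(* Mhat is a (not necessarily unique) minimizer of
   min { ||M'||_A : ||X^*(Y - X(M'))||_A^* <= lambda }. *)
Definition dantzig_solution (R : realType) (p n : nat) (A : set 'rV[R]_p)
    (X : {linear 'rV[R]_p -> 'rV[R]_n}) (Y : 'rV[R]_n) (lambda : R)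
    (Mhat : 'rV[R]_p) : Prop :=
  let feasible M' := dual_norm A (adjoint X (Y - X M')) <= lambda in
  feasible Mhat /\
  forall M', feasible M' -> atomic_norm A Mhat <= atomic_norm A M'.

(* Main.v *)
(* Let h = Mhat - M. As M is feasible, minimality of Mhat puts h in the tangent
   cone at M, so ||h||_A <= gamma ||h||_2 and phi ||h||_2 <= ||X h||_2. Both
   residuals X^*(Y - X M) and X^*(Y - X Mhat) have dual norm at most lambda, so
   ||X^* X h||_A^* <= 2 lambda and the duality of the two norms gives
   ||X h||_2^2 = <h, X^* X h> <= 2 lambda ||h||_A. The bounds follow by combining
   these three inequalities. *)
Require Import Defs.
From mathcomp Require Import all_boot all_order all_algebra.
From mathcomp Require Import all_classical all_reals all_analysis.
From mathcomp Require Import ring lra.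
Import Order.TTheory GRing.Theory Num.Theory.
Import numFieldNormedType.Exports.
Local Open Scope classical_set_scope.
Local Open Scope convex_scope.
Local Open Scope ring_scope.

Lemma dotprodC {R : realType} {p : nat} (u v : 'rV[R]_p) :
  dotprod u v = dotprod v u.
Proof. by apply: eq_bigr => i _; rewrite mulrC. Qed.

Lemma dotprodDl {R : realType} {p : nat} (u v w : 'rV[R]_p) :
  dotprod (u + v) w = dotprod u w + dotprod v w.
Proof. by rewrite -big_split; apply: eq_bigr => i _; rewrite mxE mulrDl. Qed.

Lemma dotprodZl {R : realType} {p : nat} (c : R) (u w : 'rV[R]_p) :
  dotprod (c *: u) w = c * dotprod u w.
Proof. by rewrite mulr_sumr; apply: eq_bigr => i _; rewrite mxE mulrA. Qed.

Lemma dotprodNl {R : realType} {p : nat} (u w : 'rV[R]_p) :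
  dotprod (- u) w = - dotprod u w.
Proof. by rewrite -scaleN1r dotprodZl mulN1r. Qed.

Lemma dotprod_ge0 {R : realType} {p : nat} (u : 'rV[R]_p) : 0 <= dotprod u u.
Proof. by apply: sumr_ge0 => i _; rewrite -expr2 sqr_ge0. Qed.

Lemma sqr_l2norm {R : realType} {p : nat} (u : 'rV[R]_p) :
  l2norm u ^+ 2 = dotprod u u.
Proof. by rewrite sqr_sqrtr ?dotprod_ge0. Qed.

Lemma l2norm_ge0 {R : realType} {p : nat} (u : 'rV[R]_p) : 0 <= l2norm u.
Proof. exact: sqrtr_ge0. Qed.

Lemma l2norm0 {R : realType} {p : nat} : l2norm (0 : 'rV[R]_p) = 0.
Proof.
by rewrite /l2norm -(scale0r (0 : 'rV[R]_p)) dotprodZl mul0r sqrtr0.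
Qed.

Lemma l2norm_gt0 {R : realType} {p : nat} (u : 'rV[R]_p) :
  u != 0 -> 0 < l2norm u.
Proof.
move=> u0; rewrite lt0r l2norm_ge0 andbT.
apply: contraNneq u0 => nu0.
have /eqP : dotprod u u = 0 by rewrite -sqr_l2norm nu0 expr0n.
rewrite psumr_eq0 => [/allP uu0|i _]; last by rewrite -expr2 sqr_ge0.
apply/eqP/rowP => i; rewrite mxE; apply/eqP.
by have := uu0 i (mem_index_enum _); rewrite mulf_eq0 orbb.
Qed.

(** Compactness bounds the entries of all atoms by one constant. This makes the [sup] in [dual_norm]
    an actual upper bound. *)
Lemma has_ubound_dotprod {R : realType} {p : nat} (A : set 'rV[R]_p)
    (x : 'rV[R]_p) : compact A -> has_ubound [set dotprod x a | a in A].
Proof.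
move=> /compact_bounded[N [_ /(_ (N + 1))]]; rewrite ltrDl ltr01 => /(_ isT) AN.
exists (\sum_(i < p) `|x 0 i| * (N + 1)) => _ [a Aa <-].
apply: ler_sum => i _; apply: le_trans (ler_norm _) _.
rewrite normrM; apply: ler_wpM2l => //.
apply: le_trans (AN a Aa).
rewrite /Num.norm/= mx_normrE.
exact: (le_bigmax _ (fun ij : 'I_1 * 'I_p => `|a ij.1 ij.2|) (0, i)).
Qed.

(** The half-space of all [z] with [dotprod z x <= dual_norm A x] is convex and contains [A], hence
    contains the smallest convex set around [A]. *)
Lemma le_dual_norm {R : realType} {p : nat} {A : set 'rV[R]_p}
    {x y : 'rV[R]_p} : compact A -> conv_hull A y ->
  dotprod y x <= dual_norm A x.
Proof.
move=> cA /(_ [set z | dotprod z x <= dual_norm A x]); apply; split=> [|a Aa /=].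
  move=> u v t; rewrite !inE/= => ux vx.
  rewrite [_ <| _ |> _]/(_ *: _ + (1 - _) *: _) dotprodDl !dotprodZl.
  have -> : dual_norm A x
      = t%:num * dual_norm A x + (1 - t%:num) * dual_norm A x by ring.
  by rewrite lerD// ler_wpM2l// subr_ge0.
rewrite dotprodC.
by apply: ub_le_sup; [exact: has_ubound_dotprod|exists a].
Qed.

Lemma convex_set_midpoint {R : realType} {p : nat} (K : set 'rV[R]_p)
    (x y : 'rV[R]_p) : @convex_set R 'rV[R]_p K -> K x -> K y ->
  K (2^-1 *: (x + y)).
Proof.
move=> cK Kx Ky.
have h0 : 0 <= (2^-1 : R) by lra.
have h1 : (2^-1 : R) <= 1 by lra.
have : K (2^-1 *: x + (1 - 2^-1) *: y).
  by have := cK x y (Itv01 h0 h1); rewrite !inE; exact.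
by rewrite [1 - 2^-1](_ : _ = 2^-1) ?scalerDr//; lra.
Qed.

(** If [x0] is interior, [x0 + s *: h] lies in [K] for small [s > 0], and so does [- x0] by
    symmetry; their midpoint is [(s / 2) *: h]. *)
Lemma symmetric_convex_body_absorbing {R : realType} {p : nat}
    {K : set 'rV[R]_p} (h : 'rV[R]_p) : symmetric_convex_body K ->
  exists2 t, 0 < t & exists2 y, K y & h = t *: y.
Proof.
move=> [cK _ [x0 /nbhs_ballP[e e0 xK]] sK].
(* Adding 1 keeps the divisor positive when [h = 0] and makes the norm of [s *: h] strictly less
   than [e]. *)
have h0 : 0 < `|h| + 1 by rewrite ltr_wpDl.
set s := e / (`|h| + 1).
have s0 : 0 < s by rewrite divr_gt0.
exists (2 / s); first by rewrite divr_gt0.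
have Kxs : K (x0 + s *: h).
  apply: xK; rewrite -ball_normE /= opprD addNKr normrN normrZ gtr0_norm//.
  by rewrite /s mulrAC ltr_pdivrMr// ltr_pM2l// ltrDl.
have Kx : K (- x0) by apply/sK/xK/ballxx.
exists (2^-1 *: (s *: h)).
  have -> : s *: h = x0 + s *: h - x0 by rewrite addrAC subrr add0r.
  exact: convex_set_midpoint.
rewrite !scalerA [X in X *: h](_ : _ = 1) ?scale1r//.
by field; rewrite gt_eqF.
Qed.

Lemma atomic_norm_ge0 {R : realType} {p : nat} (A : set 'rV[R]_p)
    (x : 'rV[R]_p) : 0 <= atomic_norm A x.
Proof.
rewrite /atomic_norm; set S := [set t | _].
(* By convention [inf] of the empty set is 0. *)
have [->|/set0P S0] := eqVneq S set0; first by rewrite inf0.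
by apply: lb_le_inf => // t [/ltW].
Qed.

Lemma atomic_norm0 {R : realType} {p : nat} (A : set 'rV[R]_p) :
  symmetric_convex_body (conv_hull A) -> atomic_norm A 0 = 0.
Proof.
move=> bA; apply/eqP; rewrite eq_le atomic_norm_ge0 andbT.
apply/ler_addgt0Pr => e e0; rewrite add0r.
apply: ge_inf; first by exists 0 => t [/ltW].
split=> //; exists 0; last by rewrite scaler0.
(* Writing [0 = t *: y] with [t > 0] forces [y = 0], so the hull contains 0. *)
have [t t0 [y Ky /eqP]] := symmetric_convex_body_absorbing 0 bA.
by rewrite eq_sym scaler_eq0 gt_eqF//= => /eqP <-.
Qed.

(** Any decomposition [h = s *: z] with [z] in the hull gives [dotprod h v <= c * s]; dividing by
    [c] and taking the infimum over [s] concludes. A general [c] allows direct use with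
    [2 * lambda]. *)
Lemma dotprod_le_atomic_norm {R : realType} {p : nat} (A : set 'rV[R]_p)
    (h v : 'rV[R]_p) (c : R) : symmetric_convex_body (conv_hull A) ->
  (forall y, conv_hull A y -> dotprod y v <= c) ->
  dotprod h v <= c * atomic_norm A h.
Proof.
move=> bA vc.
have [t t0 [y Ky hty]] := symmetric_convex_body_absorbing h bA.
have [_ _ _ sA] := bA.
(* By symmetry [c] bounds both [dotprod y v] and its opposite. *)
have : 0 <= c.
  have := vc y Ky; have := vc _ (sA _ Ky); rewrite dotprodNl; lra.
rewrite le_eqVlt => /predU1P[c0|c0].
  by rewrite -c0 mul0r hty dotprodZl pmulr_rle0// c0 vc.
rewrite -ler_pdivrMl//; apply: lb_le_inf; first by exists t; split=> //; exists y.
move=> s [s0 [z Kz ->]].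
by rewrite ler_pdivrMl// dotprodZl mulrC ler_pM2r// vc.
Qed.

Lemma dantzig_solution_residual {R : realType} {p n : nat} {A : set 'rV[R]_p}
    {X : {linear 'rV[R]_p -> 'rV[R]_n}} {M Mhat : 'rV[R]_p} {Z : 'rV[R]_n}
    {lambda : R} : compact A -> symmetric_convex_body (conv_hull A) ->
  dual_norm A (adjoint X Z) <= lambda ->
  dual_norm A (adjoint X (X M + Z - X Mhat)) <= lambda ->
  l2norm (X (Mhat - M)) ^+ 2 <= 2 * lambda * atomic_norm A (Mhat - M).
Proof.
move=> cA bA Zl rl; have [_ _ _ sA] := bA.
rewrite sqr_l2norm adjointP.
apply: dotprod_le_atomic_norm => // y Ky.
have -> : X (Mhat - M) = Z - (X M + Z - X Mhat).
  by rewrite raddfB/=; apply/rowP => i; rewrite !mxE; ring.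
rewrite {1}/adjoint mulmxBl -!/(adjoint X _).
rewrite dotprodC dotprodDl dotprodNl ![dotprod _ y]dotprodC.
have := le_trans (le_dual_norm cA Ky) Zl.
(* The residual at [Mhat] enters with a minus sign, so its bound is used at [- y]. *)
have := le_trans (le_dual_norm cA (sA _ Ky)) rl.
rewrite dotprodNl; lra.
Qed.

Lemma asphericity_ge0 {R : realType} {p : nat} (A : set 'rV[R]_p)
    (x : 'rV[R]_p) : (0 <= asphericity A x)%E.
Proof. by apply: ereal_sup_ubound; left. Qed.

Lemma lower_isometry_ge0 {R : realType} {p n : nat} (A : set 'rV[R]_p)
    (x : 'rV[R]_p) (X : {linear 'rV[R]_p -> 'rV[R]_n}) :
  (0 <= lower_isometry A x X)%E.
Proof.
apply/ereal_infP => _ [h _ <-].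
by rewrite lee_fin divr_ge0 ?l2norm_ge0.
Qed.

Lemma bound_div_ge0 {R : realType} (a b : \bar R) :
  (0 <= a -> 0 <= b -> 0 <= bound_div a b)%E.
Proof.
move=> a0 b0; rewrite /bound_div; case: ifPn => // _.
by rewrite mule_ge0// inve_ge0.
Qed.

Lemma bound_div_fin {R : realType} (a b : R) : b != 0 ->
  bound_div a%:E b%:E = (a / b)%:E.
Proof. by move=> b0; rewrite /bound_div eqe (negbTE b0) inver (negbTE b0). Qed.

Lemma bound_divy {R : realType} (b : R) : 0 < b ->
  bound_div +oo%E b%:E = +oo%E.
Proof.
move=> b0; rewrite /bound_div; case: ifPn => // _.
by rewrite inver gt_eqF// gt0_mulye// lte_fin invr_gt0.
Qed.

(* To be applied to [a = ||h||_2], [b = ||h||_A], [c = ||X h||_2] for the error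
   [h = Mhat - M]. If [gamma = +oo] the bounds hold because [phi > 0] forces
   [c > 0], hence [lambda > 0]. *)
Lemma error_bounds {R : realType} (a b c lambda : R) (gamma phi : \bar R) :
  0 < a -> 0 <= b -> 0 <= c -> c ^+ 2 <= 2 * lambda * b ->
  ((b / a)%:E <= gamma -> 0 <= phi -> phi <= (c / a)%:E ->
  [/\ a%:E <= bound_div (2%:E * gamma * lambda%:E) (phi ^+ 2),
      b%:E <= bound_div (2%:E * gamma ^+ 2 * lambda%:E) (phi ^+ 2)
    & c%:E <= bound_div (2%:E * gamma * lambda%:E) phi])%E.
Proof.
move=> a0 b0 c0 c2.
case: phi => [r| |]// bg; rewrite !lee_fin => r0 rc.
move: r0; rewrite le_eqVlt => /predU1P[<-|r0].
  by rewrite /bound_div expe2 mul0e eqxx !leey.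
move: rc; rewrite ler_pdivlMr// => rc.
have cgt0 : 0 < c by apply: lt_le_trans rc; rewrite mulr_gt0.
have lbgt0 : 0 < 2 * lambda * b by apply: lt_le_trans c2; rewrite exprn_gt0.
have l0 : 0 < lambda.
  move: b0 lbgt0; rewrite le_eqVlt => /predU1P[<-|b0]; first by rewrite mulr0 ltxx.
  by rewrite pmulr_lgt0// pmulr_rgt0.
have r2 : 0 < r ^+ 2 by rewrite exprn_gt0.
rewrite -EFin_expe.
case: gamma bg => [g| |]//; last first.
  by rewrite expe2 mulyy gt0_muley// gt0_mulye// !bound_divy// !leey.
rewrite lee_fin ler_pdivrMr// => bg.
rewrite -EFin_expe -!EFinM !bound_div_fin ?gt_eqF// !lee_fin !ler_pdivlMr//.
(* Cancel [a] in [(r * a)^2 <= c^2 <= 2 * lambda * b <= 2 * lambda * g * a]. *)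
have ar2 : a * r ^+ 2 <= 2 * g * lambda.
  rewrite -(ler_pM2r a0); apply: (@le_trans _ _ (c ^+ 2)).
    rewrite (_ : _ * a = (r * a) ^+ 2); last by ring.
    by rewrite ler_sqr ?nnegrE// ltW// mulr_gt0.
  apply: le_trans c2 _; rewrite (_ : _ * a = 2 * lambda * (g * a)); last by ring.
  by rewrite ler_wpM2l// mulr_ge0// ltW.
have g0 : 0 <= g by nra.
split=> //.
  apply: (@le_trans _ _ (g * (a * r ^+ 2))); first by rewrite mulrA ler_pM2r.
  by rewrite (_ : 2 * _ * _ = g * (2 * g * lambda)) ?ler_wpM2l//; ring.
(* After multiplication by [c], the chain is [r * c^2 <= r * 2 * lambda * b <= 2 * g * lambda * (r *
   a) <= 2 * g * lambda * c]. *)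
rewrite -(ler_pM2r cgt0).
apply: (@le_trans _ _ (r * (2 * lambda * b))).
  by rewrite (_ : _ * c = r * c ^+ 2) ?ler_pM2l//; ring.
apply: (@le_trans _ _ (2 * g * lambda * (r * a))).
  rewrite (_ : 2 * g * _ * _ = r * (2 * lambda * (g * a))); last by ring.
  by rewrite ler_pM2l// ler_wpM2l// mulr_ge0// ltW.
by rewrite ler_wpM2l// !mulr_ge0// ltW.
Qed.

Theorem theorem4 (R : realType) (p n : nat) (A : set 'rV[R]_p)
    (hA : atom_set A)
    (X : {linear 'rV[R]_p -> 'rV[R]_n}) (M : 'rV[R]_p) (Z Y : 'rV[R]_n)
    (hY : Y = X M + Z)
    (lambda : R) (hlambda : dual_norm A (adjoint X Z) <= lambda)
    (Mhat : 'rV[R]_p) (hMhat : dantzig_solution A X Y lambda Mhat) :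
  let gamma := asphericity A M in
  let phi := lower_isometry A M X in
  [/\ ((l2norm (Mhat - M))%:E
         <= bound_div (2%:E * gamma * lambda%:E) (phi ^+ 2))%E,
      ((atomic_norm A (Mhat - M))%:E
         <= bound_div (2%:E * gamma ^+ 2 * lambda%:E) (phi ^+ 2))%E
    & ((l2norm (X (Mhat - M)))%:E
         <= bound_div (2%:E * gamma * lambda%:E) phi)%E].
Proof.
move=> gamma phi.
have [cA _ bA] := hA.
move: hMhat; rewrite hY => -[feas opt].
have res := dantzig_solution_residual cA bA hlambda feas.
have gamma0 : (0 <= gamma)%E := asphericity_ge0 A M.
have phi0 : (0 <= phi)%E := lower_isometry_ge0 A M X.
(* A zero error is excluded from the ratios defining [gamma] and [phi]. The left sides then vanish,
   and it remains to see that the bounds are nonnegative, which follows from [0 <= lambda]. *)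
have [h0|h0] := eqVneq (Mhat - M) 0.
  have l0 : 0 <= lambda.
    have [_ _ [x /interior_subset Kx] sA] := bA.
    have := le_trans (le_dual_norm cA Kx) hlambda.
    have := le_trans (le_dual_norm cA (sA _ Kx)) hlambda.
    rewrite dotprodNl; lra.
  rewrite h0 linear0 !l2norm0 (atomic_norm0 A bA).
  by split; apply: bound_div_ge0; rewrite ?expe_ge0 ?mule_ge0 ?expe_ge0// lee_fin.
have Th : tangent_cone A M (Mhat - M).
  exists 1; split=> //; exists (Mhat - M); last by rewrite scale1r.
  rewrite /= subrKC; apply: opt.
  (* [M] is feasible because its residual is exactly [Z]. *)
  by rewrite addrAC subrr add0r.
apply: error_bounds; rewrite ?l2norm_gt0 ?l2norm_ge0 ?atomic_norm_ge0//.
  by apply: ereal_sup_ubound; right; exists (Mhat - M).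
by apply: ereal_inf_lbound; exists (Mhat - M).
Qed.
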